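(* Let $R$ be a coherent ring and let $P\in\mathrm{Max}\ R\cup(\mathrm{Spec}\ R\setminus\mathrm{Min}\ R)$, i.e. $P$ is a prime ideal of $R$ which is maximal or is not a minimal prime. If $P^n$ is finitely generated for some integer $n>0$, then $P$ is finitely generated.
   Context: All rings are commutative with identity. A ring is coherent if each of its finitely generated ideals is finitely presented. $\mathrm{Spec}\ R$, $\mathrm{Max}\ R$, $\mathrm{Min}\ R$ denote the sets of prime ideals, maximal ideals and minimal prime ideals of $R$, respectively. *)

(* Defs.v *)
From mathcomp Require Import all_boot all_algebra.
From mathcomp Require Import mathcomp_extra boolp classical_sets cardinality.

Set Implicit Arguments.
Unset Strict Implicit.
Unset Printing Implicit Defensive.

Import GRing.Theory.

Local Open Scope classical_set_scope.
Local Open Scope ring_scope.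

Definition submodule (R : pzRingType) (V : lmodType R) (N : set V) : Prop :=
  submod_closed (mem N).

Definition submodule_gen (R : pzRingType) (V : lmodType R) (A : set V) : set V :=
  smallest (@submodule R V) A.

Definition fin_gen (R : pzRingType) (V : lmodType R) (N : set V) : Prop :=
  exists2 A : set V, finite_set A & N = submodule_gen A.

(* There is an exact sequence R^m -> R^n -> N -> 0. The map R^n -> N is given
   as a map to the ambient module V with image N. *)
Definition fin_presented (R : pzRingType) (V : lmodType R) (N : set V) : Prop :=
  exists (m n : nat) (g : {linear 'rV[R]_m -> 'rV[R]_n})
         (f : {linear 'rV[R]_n -> V}),
    range f = N /\ range g = [set x | f x = 0].

(* Ideals are the submodules of the regular module R^o; unlike idealr_closed,
   this allows the unit ideal. *)
Definition ideal (R : comPzRingType) (I : set R) : Prop :=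
  @submodule R R^o I.

Definition ideal_gen (R : comPzRingType) (A : set R) : set R :=
  @submodule_gen R R^o A.

Definition ideal_fin_gen (R : comPzRingType) (I : set R) : Prop :=
  @fin_gen R R^o I.

Definition ideal_fin_presented (R : comPzRingType) (I : set R) : Prop :=
  @fin_presented R R^o I.

Definition coherent (R : comPzRingType) : Prop :=
  forall I : set R, ideal I -> ideal_fin_gen I -> ideal_fin_presented I.

Definition ideal_mul (R : comPzRingType) (I J : set R) : set R :=
  ideal_gen [set x * y | x in I & y in J].

Definition ideal_exp (R : comPzRingType) (I : set R) (n : nat) : set R :=
  iter n (ideal_mul I) setT.

Definition Spec (R : comPzRingType) : set (set R) :=
  [set P | [/\ ideal P, ~ P 1 & forall x y, P (x * y) -> P x \/ P y]].

Definition Max (R : comPzRingType) : set (set R) :=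
  [set M | [/\ ideal M, M <> setT &
    forall J, ideal J -> M `<=` J -> J = M \/ J = setT]].

Definition Min (R : comPzRingType) : set (set R) :=
  [set P | Spec P /\ forall Q, Spec Q -> Q `<=` P -> Q = P].

Arguments Spec R : clear implicits.
Arguments Max R : clear implicits.
Arguments Min R : clear implicits.

(* Main.v *)
(** Consider the colon ideals [(P^(n+1) : x)] with [x] in [P^n]: they contain
    [P], and over a coherent ring they are finitely generated as soon as
    [P^(n+1)] is. If [P] is maximal, any [x] in [P^n] outside [P^(n+1)] gives
    [P = (P^(n+1) : x)]; if there is none, then [P^n = P^(n+1)] and one
    concludes by induction on [n]. If [P] is prime and no such colon ideal
    equals [P], then [P^n] and [P^(n+1)] agree after localizing at [P], so that
    Nakayama's lemma yields [t] outside [P] with [t P^(n+1) = 0], and this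
    forces [P] to be a minimal prime. *)
Require Import Defs.
From mathcomp Require Import all_boot all_algebra.
From mathcomp Require Import mathcomp_extra boolp classical_sets cardinality.

Set Implicit Arguments.
Unset Strict Implicit.
Unset Printing Implicit Defensive.

Import GRing.Theory.

Local Open Scope classical_set_scope.
Local Open Scope ring_scope.

(** * Ideals and their powers *)

Lemma idealP (R : comPzRingType) (I : set R) :
  ideal I <-> I 0 /\ forall a x y, I x -> I y -> I (a * x + y).
Proof.
split=> [[I0 IL]|[I0 IL]].
  split=> [|a x y Ix Iy]; first by move: I0; rewrite inE.
  by have := IL a x y; rewrite !inE; apply.
by split=> [|a x y]; rewrite !inE //; exact: IL.
Qed.

Section Ideals.
Variable R : comPzRingType.
Implicit Types (I P Q A : set R) (x y : R).

Lemma ideal0 I : ideal I -> I 0.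
Proof. by case/idealP. Qed.

Lemma idealD I x y : ideal I -> I x -> I y -> I (x + y).
Proof. by case/idealP=> _ IL Ix Iy; rewrite -[x]mul1r; apply: IL. Qed.

Lemma idealMl I a x : ideal I -> I x -> I (a * x).
Proof. by case/idealP=> I0 IL Ix; rewrite -[_ * _]addr0; apply: IL. Qed.

Lemma idealMr I a x : ideal I -> I x -> I (x * a).
Proof. by rewrite mulrC; apply: idealMl. Qed.

Lemma idealB I x y : ideal I -> I x -> I y -> I (x - y).
Proof.
by move=> idI Ix Iy; rewrite -mulN1r; apply: idealD => //; apply: idealMl.
Qed.

Lemma ideal_sum I k (F : 'I_k -> R) :
  ideal I -> (forall i, I (F i)) -> I (\sum_i F i).
Proof.
by move=> idI IF; elim/big_ind: _ => // [|*]; [apply: ideal0|apply: idealD].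
Qed.

Lemma ideal_setT : ideal (@setT R).
Proof. exact/idealP. Qed.

Lemma ideal_gen_ideal A : ideal (ideal_gen A).
Proof.
apply/idealP; split=> [I [/idealP[]//]|a x y Ax Ay I [idI AI]].
by apply: idealD => //; [apply: idealMl => //; apply: Ax|apply: Ay].
Qed.

Lemma sub_ideal_gen A : A `<=` ideal_gen A.
Proof. exact: sub_smallest. Qed.

Lemma ideal_gen_sub A I : ideal I -> A `<=` I -> ideal_gen A `<=` I.
Proof. exact: smallest_sub. Qed.

Lemma ideal_exp_ideal P n : ideal (ideal_exp P n).
Proof. by case: n => [|n]; [apply: ideal_setT|apply: ideal_gen_ideal]. Qed.

Lemma ideal_expS_mul P n x y :
  P x -> ideal_exp P n y -> ideal_exp P n.+1 (x * y).
Proof. by move=> Px Py; apply: sub_ideal_gen; exists x => //; exists y. Qed.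

Lemma ideal_expS_sub P n : ideal_exp P n.+1 `<=` ideal_exp P n.
Proof.
apply: ideal_gen_sub; first exact: ideal_exp_ideal.
by move=> _ [x _ [y Py <-]]; apply: idealMl => //; apply: ideal_exp_ideal.
Qed.

Lemma ideal_exp1 P : ideal P -> ideal_exp P 1 = P.
Proof.
move=> idP; apply/seteqP; split=> [|x Px].
  by apply: ideal_gen_sub => // _ [x Px [y _ <-]]; apply: idealMr.
by rewrite -[x]mulr1; apply: ideal_expS_mul.
Qed.

Lemma ideal_expX P n x : P x -> ideal_exp P n (x ^+ n).
Proof.
by move=> Px; elim: n => // n IHn; rewrite exprS; apply: ideal_expS_mul.
Qed.

Lemma Spec_exp Q n x : Spec R Q -> Q (x ^+ n) -> Q x.
Proof.
by case=> _ Q1 Qp; elim: n => // n IHn; rewrite exprS => /Qp[].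
Qed.

(** * Finite linear combinations *)

(** For an ideal [P] this is the product of [P] with the ideal generated by the [a i]; taking [setT]
    for [P] gives the latter ideal itself. *)
Definition lincomb P k (a : 'I_k -> R) : set R :=
  [set \sum_i c i * a i | c in [set c | forall i, P (c i)]].

Lemma lincomb_ideal P k (a : 'I_k -> R) : ideal P -> ideal (lincomb P a).
Proof.
move=> idP; apply/idealP; split.
  exists (fun=> 0) => [i|]; first exact: ideal0.
  by apply: big1 => i _; rewrite mul0r.
move=> b _ _ [c Pc <-] [d Pd <-]; exists (fun i => b * c i + d i) => [i|].
  by apply: idealD => //; apply: idealMl.
by rewrite mulr_sumr -big_split; apply: eq_bigr => i _; rewrite mulrDl mulrA.
Qed.

Lemma ideal_gen_range k (a : 'I_k -> R) :
  ideal_gen (range a) = lincomb setT a.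
Proof.
apply/seteqP; split.
  apply: ideal_gen_sub; first by apply: lincomb_ideal; apply: ideal_setT.
  move=> _ [j _ <-]; exists (fun i => (i == j)%:R) => //.
  rewrite (bigD1 j) //= eqxx mul1r big1 ?addr0 //.
  by move=> i /negbTE ->; rewrite mul0r.
move=> _ [c _ <-]; have idA := ideal_gen_ideal (range a).
apply: (ideal_sum idA) => i; apply: (idealMl _ idA).
by apply: sub_ideal_gen; exists i.
Qed.

Lemma ideal_fin_gen_lincomb I :
  ideal_fin_gen I -> exists k (a : 'I_k -> R), I = lincomb setT a.
Proof.
case=> A /finite_seqP[s ->] ->; exists (size s), (fun i => s`_i).
rewrite -ideal_gen_range; congr ideal_gen; apply/seteqP; split=> [x /= xs|].
  have xs' := xs; rewrite -index_mem in xs'.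
  by exists (Ordinal xs') => //=; rewrite nth_index.
by move=> _ [i _ <-]; rewrite /= mem_nth.
Qed.

(** The [y] that admit such a [d] form an ideal; it contains [x] by [d = 1] and [A] by [d = 0]. *)
Lemma ideal_gen_setU1 x A y :
  ideal_gen (x |` A) y -> exists d, ideal_gen A (y - d * x).
Proof.
have idA := ideal_gen_ideal A.
apply: (@ideal_gen_sub _ [set y | exists d, ideal_gen A (y - d * x)]).
  apply/idealP; split=> [|b u v [d Ad] [e Ae]].
    by exists 0; rewrite mul0r subr0; apply: ideal0.
  exists (b * d + e).
  have -> : b * u + v - (b * d + e) * x = b * (u - d * x) + (v - e * x).
    by rewrite mulrDl mulrBr opprD mulrA addrACA.
  by apply: (idealD idA) => //; apply: (idealMl _ idA).
move=> z [->|Az]; first by exists 1; rewrite mul1r subrr; apply: ideal0.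
by exists 0; rewrite mul0r subr0; apply: sub_ideal_gen.
Qed.

(** * Colon ideals and localization at a prime *)

Definition colon I x : set R := [set r | I (r * x)].

Lemma colon_ideal I x : ideal I -> ideal (colon I x).
Proof.
move=> idI; apply/idealP; rewrite /colon /= mul0r; split; first exact: ideal0.
move=> a r s Ir Is; rewrite mulrDl -mulrA.
by apply: (idealD idI) => //; apply: (idealMl _ idI).
Qed.

(* In a presentation [R^m -> R^n -> I + Rx -> 0], the relations between [x] and
   the elements of [I] come from the finitely many relations of the
   presentation; [phi] reads off the coefficient of [x]. *)
Lemma colon_fin_gen I x :
  coherent R -> ideal I -> ideal_fin_gen I -> ideal_fin_gen (colon I x).
Proof.
move=> cohR idI [A finA IA].
pose J := ideal_gen (x |` A).
have idJ : ideal J by apply: ideal_gen_ideal.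
have finJ : ideal_fin_gen J.
  by exists (x |` A) => //; rewrite finite_setU; split.
have [m [n [g [f [fJ gf]]]]] := cohR J idJ finJ.
have [k [a Ia]] := @ideal_fin_gen_lincomb I (ex_intro2 _ _ A finA IA).
have fP v : J (f v) by rewrite -fJ; exists v.
have Jf y : J y -> exists v, f v = y by rewrite -fJ => -[v _ <-]; exists v.
have IJ y : I y -> J y.
  rewrite IA; apply: ideal_gen_sub => // z Az.
  by apply: sub_ideal_gen; right.
have [w fw] : exists w, f w = x by apply: Jf; apply: sub_ideal_gen; left.
have aI i : I (a i).
  rewrite Ia -ideal_gen_range; apply: sub_ideal_gen; by exists i.
have [v fv] : {v | forall i, f (v i) = a i}.
  suff /choice[v fv] : forall i, exists u, f u = a i by exists v.
  by move=> i; apply: Jf; apply: IJ.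
have [d dP] : {d | forall l, I (f (delta_mx 0 l) - d l * x)}.
  suff /choice[d dP] : forall l, exists e, I (f (delta_mx 0 l) - e * x).
    by exists d.
  by move=> l; rewrite IA; apply: ideal_gen_setU1; apply: fP.
pose phi (u : 'rV[R]_n) := (u *m \col_l d l) 0 0.
have phiE u : I (f u - phi u * x).
  rewrite {1}[u]row_sum_delta linear_sum /phi mxE mulr_suml -sumrB.
  apply: (ideal_sum idI) => l; rewrite linearZ mxE -mulrA -mulrBr.
  exact: (idealMl _ idI).
have phi_colon u : I (f u) -> colon I x (phi u).
  move=> Ifu; rewrite /colon /=.
  have -> : phi u * x = f u - (f u - phi u * x) by rewrite opprB addrC subrK.
  exact: idealB.
(* Each generator is [phi u] up to a multiple of [x] lying in [I]: [1 - phi w] comes from [f w = x],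
   the others from vectors that [f] maps to some [a i] or to 0. *)
pose B := [set 1 - phi w] `|` range (fun i => phi (v i))
          `|` range (fun j => phi (g (delta_mx 0 j))).
exists B.
  by rewrite !finite_setU; split; [split|]; [exact: finite_set1| |];
    apply: finite_image; apply: finite_finset.
have idB : ideal (ideal_gen B) by apply: ideal_gen_ideal.
apply/seteqP; split; last first.
  apply: ideal_gen_sub; first exact: colon_ideal.
  move=> _ [[->|[i _ <-]]|[j _ <-]].
  - by rewrite /colon /= mulrBl mul1r -{1}fw.
  - by apply: phi_colon; rewrite fv.
  - apply: phi_colon.
    have : range g (g (delta_mx 0 j)) by exists (delta_mx 0 j).
    by rewrite gf /= => ->; apply: ideal0.
(* Writing [r * x] as a combination of the [a i] produces a relation, hence an element of the range
   of [g]; applying [phi] to it expresses [r * phi w] through [B]. *)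
move=> r; rewrite /colon /= {1}Ia => -[c _ cE].
have : range g (r *: w - \sum_i c i *: v i).
  rewrite gf /= linearB linearZ linear_sum fw /= -[r *: _]/(r * x) -cE.
  by apply/eqP; rewrite subr_eq0; apply/eqP/eq_bigr => i _; rewrite linearZ fv.
case=> y _ yE.
have phi_sum q (F : 'I_q -> R) u :
    phi (\sum_i F i *: u i) = \sum_i F i * phi (u i).
  rewrite /phi mulmx_suml summxE; apply: eq_bigr => i _.
  by rewrite -scalemxAl mxE.
have wE : r *: w = \sum_i c i *: v i + \sum_j y 0 j *: g (delta_mx 0 j).
  rewrite addrC -[LHS](subrK (\sum_i c i *: v i)) -yE; congr (_ + _).
  rewrite {1}[y]row_sum_delta linear_sum.
  by apply: eq_bigr => j _; rewrite linearZ.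
have rE : r * phi w = \sum_i c i * phi (v i)
                    + \sum_j y 0 j * phi (g (delta_mx 0 j)).
  have -> : r * phi w = phi (r *: w) by rewrite /phi -scalemxAl [RHS]mxE.
  by rewrite wE -!phi_sum /phi mulmxDl [LHS]mxE.
have -> : r = r * (1 - phi w) + (\sum_i c i * phi (v i)
                    + \sum_j y 0 j * phi (g (delta_mx 0 j))).
  by rewrite -rE mulrBr mulr1 subrK.
apply: (idealD idB); last apply: (idealD idB).
- by apply: (idealMl _ idB); apply: sub_ideal_gen; left; left.
- apply: (ideal_sum idB) => i; apply: (idealMl _ idB).
  by apply: sub_ideal_gen; left; right; exists i.
- apply: (ideal_sum idB) => j; apply: (idealMl _ idB).
  by apply: sub_ideal_gen; right; exists j.
Qed.

(* Nakayama's lemma for the localization at [P], by induction on the number of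
   generators: a relation [s a_0 = sum p_i a_i] with [p_i] in [P] shows that
   [s - p_0], which is a unit at [P], multiplies [a_0] into the span of the
   other generators. *)
Lemma local_nakayama P k (a : 'I_k -> R) :
  Spec R P ->
  (forall x, lincomb setT a x -> exists2 s, ~ P s & lincomb P a (s * x)) ->
  exists2 t, ~ P t & forall x, lincomb setT a x -> t * x = 0.
Proof.
case=> idP P1 Pp; elim: k a => [|k IHk] a aP.
  by exists 1 => // _ [c _ <-]; rewrite big_ord0 mulr0.
pose a' i := a (lift ord0 i).
have [s Ps [p Pp' sE]] : exists2 s, ~ P s & lincomb P a (s * a ord0).
  apply: aP; rewrite -ideal_gen_range; apply: sub_ideal_gen; by exists ord0.
pose u := s - p ord0.
have Pu : ~ P u.
  by move=> Pu; apply: Ps; rewrite -[s](subrK (p ord0)); apply: idealD.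
have uE : u * a ord0 = \sum_i p (lift ord0 i) * a' i.
  by rewrite mulrBl -sE big_ord_recl addrC addKr.
(* Multiplication by [u] eliminates [a ord0] and keeps the coefficients in [Q]. The case of [P]
   gives the hypothesis of the induction, that of [setT] its conclusion. *)
have u_lincomb Q c : ideal Q -> (forall i, Q (c i)) ->
    lincomb Q a' (u * \sum_i c i * a i).
  move=> idQ Qc; rewrite big_ord_recl mulrDr mulrCA uE.
  exists (fun i => c ord0 * p (lift ord0 i) + u * c (lift ord0 i)) => [i|].
    by apply: idealD => //; [apply: idealMr|apply: idealMl].
  rewrite !mulr_sumr -big_split; apply: eq_bigr => i _ /=.
  by rewrite mulrDl !mulrA.
have [|t Pt tE] := IHk a'.
  move=> _ [c _ <-].
  have [|r Pr [q Pq qE]] := aP (\sum_i c i * a' i).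
    (* The combination of the [a' i] is extended by the coefficient 0 at [a ord0]. *)
    exists (fun i => oapp c 0 (unlift ord0 i)) => //.
    rewrite big_ord_recl unlift_none mul0r add0r.
    by apply: eq_bigr => i _; rewrite liftK.
  exists (u * r); first by case/Pp.
  by rewrite -mulrA -qE; apply: u_lincomb.
exists (t * u); first by case/Pp.
move=> _ [c _ <-]; rewrite -mulrA; apply: tE.
by apply: u_lincomb => //; apply: ideal_setT.
Qed.

(** * The maximal and the non-minimal case *)

Lemma Max_fin_gen P n :
  coherent R -> Max R P -> ideal_fin_gen (ideal_exp P n.+1) -> ideal_fin_gen P.
Proof.
move=> cohR [idP PT maxP].
elim: n => [|n IHn]; first by rewrite ideal_exp1.
move=> finPn.
have [Pn|] := pselect (ideal_exp P n.+1 `<=` ideal_exp P n.+2).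
  apply: IHn; suff -> : ideal_exp P n.+1 = ideal_exp P n.+2 by [].
  by apply/seteqP; split=> //; apply: ideal_expS_sub.
move=> /existsNP[x /not_implyP[Px Px']].
have idPn := ideal_exp_ideal P n.+2.
have := colon_fin_gen x cohR idPn finPn.
(* The colon ideal contains [P], so it is [P] or the whole ring; the latter would put [x] in the
   higher power. *)
have [|->|colonT _] // := maxP _ (colon_ideal x idPn).
  by move=> p Pp; apply: ideal_expS_mul.
have : colon (ideal_exp P n.+2) x 1 by rewrite colonT.
by rewrite /colon /= mul1r.
Qed.

Lemma Spec_Min_fin_gen P n :
  coherent R -> Spec R P -> ~ Min R P -> ideal_fin_gen (ideal_exp P n.+1) ->
  ideal_fin_gen P.
Proof.
move=> cohR specP minP finPn; have [idP P1 Pp] := specP.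
have idPn := ideal_exp_ideal P n.+1.
have [[x Px xP]|noX] := pselect (exists2 x,
    ideal_exp P n x & colon (ideal_exp P n.+1) x `<=` P).
  suff <- : colon (ideal_exp P n.+1) x = P by apply: colon_fin_gen.
  by apply/seteqP; split=> // p pP; apply: ideal_expS_mul.
(* Minimality of [P] is derived for a contradiction: any prime [Q] inside [P] contains [P]. *)
case: minP; split=> // Q specQ QP; apply/seteqP; split=> // x Px.
have [k [a aE]] := ideal_fin_gen_lincomb finPn.
have [t Pt tE] : exists2 t, ~ P t & forall x, lincomb setT a x -> t * x = 0.
  apply: local_nakayama => // y; rewrite -aE; move: y.
  have idPa : ideal (lincomb P a) by apply: lincomb_ideal.
  (* The [y] that some [s] outside [P] multiplies into [lincomb P a] form an ideal, so products
     [p * y] with [y] in the [n]-th power suffice. *)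
  apply: ideal_gen_sub.
    apply/idealP; split=> [|b y z [s Ps sy] [r Pr rz]].
      by exists 1 => //; rewrite mulr0; apply: ideal0.
    exists (s * r); first by case/Pp.
    rewrite mulrDr -[s * r * z]mulrA [s * r]mulrC mulrACA.
    by apply: (idealD idPa); apply: (idealMl _ idPa).
  move=> _ [p pP [y Py <-]].
  (* Some [s] outside [P] brings [y] into the span of [a]; the factor [p] then moves the
     coefficients into [P]. *)
  have /existsNP[s /not_implyP[sy Ps]] :
      ~ (colon (ideal_exp P n.+1) y `<=` P) by move=> yP; apply: noX; exists y.
  exists s => //; move: sy; rewrite /colon aE => -[c _ cE].
  rewrite mulrCA -cE mulr_sumr; exists (fun i => p * c i) => [i|].
    exact: idealMr.
  by apply: eq_bigr => i _; rewrite mulrA.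
(* The product is 0, and [t] is outside [P], hence outside [Q]; so [Q] contains a power of [x]. *)
have Q0 : Q (t * x ^+ n.+1).
  by rewrite tE -?aE; [case: specQ => /ideal0|apply: ideal_expX].
case: (specQ) => _ _ /(_ _ _ Q0)[/QP //|]; exact: Spec_exp.
Qed.

End Ideals.

Theorem theorem3p3 (R : comPzRingType) (P : set R) (n : nat) :
  coherent R ->
  (Max R `|` (Spec R `\` Min R)) P ->
  (0 < n)%N -> ideal_fin_gen (ideal_exp P n) ->
  ideal_fin_gen P.
Proof.
case: n => // n cohR [maxP|[specP minP]] _; first exact: Max_fin_gen.
exact: Spec_Min_fin_gen.
Qed.
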